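(* Let $n$ be a natural number, let $\mathfrak{T}$ and $\mathfrak{S}$ be $\mathcal{L}$-trees, and let $a,b\in T$ and $c,d\in S$ with $a<_{\mathfrak{T}}b$ and $c<_{\mathfrak{S}}d$ be such that $(\mathfrak{T};a,b)\equiv^{n+1}(\mathfrak{S};c,d)$. Then $\left(\mathfrak{T}_{\mathsf{cs}}^{(a,b)};(a,b)\right)\equiv^n\left(\mathfrak{S}_{\mathsf{cs}}^{(c,d)};(c,d)\right)$.
   Context: A tree is a structure $\mathfrak{T}=(T;<)$ with $T$ non-empty and $<$ a strict partial order that is downwards linear (each set $\{x : x \leqslant t\}$ is totally ordered) and downwards connected (for all $s,t$ there is $x$ with $x\leqslant s$ and $x\leqslant t$). The language $\mathcal{L}$ consists of $=$, $<$ and finitely many constants and unary predicates; an $\mathcal{L}$-tree is a tree in this language. $(\mathfrak{T};\bar a)$ and $(\mathfrak{T};A)$ denote expansions by constants $\bar a$, respectively a unary predicate $A$. $(a,b)=\{x : a<x<b\}$. $\equiv^n$ denotes agreement on all first-order sentences of quantifier rank at most $n$. Natural numbers include $0$. For $a\in T$ the co-forest of $a$ has underlying set $T_{\mathsf{cf}}^{a}=\{x\in T : a\not<x\text{ and } y<x\text{ for all }y<a\}$. For $a<b$, the open cross section $\mathfrak{T}_{\mathsf{cs}}^{(a,b)}$ is the restriction of $\mathfrak{T}$ to $T_{\mathsf{cs}}^{(a,b)}=\{x\in T : a<x,\ b\not<x,\ x\notin T_{\mathsf{cf}}^{b}\}$. When a tree is restricted to a subset, constants of the language lying outside the subset are dropped;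 $n$-equivalence of two restrictions includes that the same constants are retained in both. Restrictions may be empty. *)

(* Defs.v *)
From mathcomp Require Import all_boot.
From mathcomp Require Import boolp classical_sets.

Set Implicit Arguments.
Unset Strict Implicit.
Unset Printing Implicit Defensive.

Local Open Scope classical_set_scope.

(* The symbols = and < are common to all languages. *)
Record language := Language { consts : finType; preds : finType }.

(* Carriers may be empty, and a constant may be dropped (value [None]), so that
   restrictions to subsets are again structures for the same [L]. *)
Record structure (L : language) := Structure {
  carrier :> Type;
  lt : carrier -> carrier -> Prop;
  const : consts L -> option carrier;
  upred : preds L -> set carrier }.

Section Syntax.
Variable L : language.

(* [V] is the type of free variables; a quantifier binds the variable [None].
   There is no ambient valuation of unused variables, so satisfaction of
   sentences also makes sense in an empty structure. *)
Inductive term (V : Type) : Type :=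
| Var of V
| Cst of consts L.

Inductive formula : Type -> Type :=
| Fls V : formula V
| Eq V : term V -> term V -> formula V
| Lt V : term V -> term V -> formula V
| Prd V : preds L -> term V -> formula V
| Imp V : formula V -> formula V -> formula V
| And V : formula V -> formula V -> formula V
| Or V : formula V -> formula V -> formula V
| All V : formula (option V) -> formula V
| Ex V : formula (option V) -> formula V.

Definition sentence := formula void.

Fixpoint qrank V (f : formula V) : nat :=
  match f with
  | Fls _ | Eq _ _ _ | Lt _ _ _ | Prd _ _ _ => 0
  | Imp _ g h | And _ g h | Or _ g h => maxn (qrank g) (qrank h)
  | All _ g | Ex _ g => (qrank g).+1
  end.

Definition term_over (D : pred (consts L)) V (t : term V) : bool :=
  if t is Cst c then D c else true.

Fixpoint formula_over (D : pred (consts L)) V (f : formula V) : bool :=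
  match f with
  | Fls _ => true
  | Eq _ s t | Lt _ s t => term_over D s && term_over D t
  | Prd _ _ t => term_over D t
  | Imp _ g h | And _ g h | Or _ g h => formula_over D g && formula_over D h
  | All _ g | Ex _ g => formula_over D g
  end.

End Syntax.

Section Semantics.
Variables (L : language) (M : structure L).

Definition eval V (e : V -> M) (t : term L V) : option M :=
  match t with Var v => Some (e v) | Cst c => const M c end.

(* The value of an atom mentioning a dropped constant is irrelevant: such
   formulas are excluded in [nequiv]. *)
Fixpoint sat V (f : formula L V) : (V -> M) -> Prop :=
  match f in formula _ V return (V -> M) -> Prop with
  | Fls _ => fun=> False
  | Eq _ s t => fun e =>
      if (eval e s, eval e t) is (Some x, Some y) then x = y else False
  | Lt _ s t => fun e =>
      if (eval e s, eval e t) is (Some x, Some y) then lt x y else False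
  | Prd _ p t => fun e => if eval e t is Some x then upred p x else False
  | Imp _ g h => fun e => sat g e -> sat h e
  | And _ g h => fun e => sat g e /\ sat h e
  | Or _ g h => fun e => sat g e \/ sat h e
  | All _ g => fun e => forall x : M, sat g (oapp e x)
  | Ex _ g => fun e => exists x : M, sat g (oapp e x)
  end.

Definition models (f : sentence L) : Prop := sat f (of_void M).

Definition retained : pred (consts L) := fun c => isSome (const M c).

End Semantics.

Definition nequiv (n : nat) L (M N : structure L) : Prop :=
  retained M =1 retained N /\
  forall f : sentence L, formula_over (retained M) f -> qrank f <= n ->
    (models M f <-> models N f).

Definition add_consts (L : language) (k : nat) : language :=
  Language (consts L + 'I_k)%type (preds L).

Definition expand_consts L (M : structure L) k (a : k.-tuple M) :
    structure (add_consts L k) :=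
  @Structure (add_consts L k) M (@lt L M)
    (fun c => match c with inl c => const M c | inr i => Some (tnth a i) end)
    (@upred L M).

Definition add_pred (L : language) : language :=
  Language (consts L) (option (preds L)).

Definition expand_pred L (M : structure L) (A : set M) :
    structure (add_pred L) :=
  @Structure (add_pred L) M (@lt L M) (@const L M) (oapp (@upred L M) A).

Definition restrict L (M : structure L) (A : set M) : structure L :=
  @Structure L (set_type A)
    (fun x y => lt (val x) (val y))
    (fun c => obind insub (const M c))
    (fun p => val @^-1` upred p).

Section Trees.
Variables (L : language) (M : structure L).

Definition le (x y : M) : Prop := x = y \/ lt x y.

Record is_tree : Prop := IsTree {
  tree_inhabited : inhabited M;
  tree_irrefl : forall x : M, ~ lt x x;
  tree_trans : forall x y z : M, lt x y -> lt y z -> lt x z;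
  tree_linear : forall t x y : M, le x t -> le y t -> le x y \/ le y x;
  tree_connected : forall s t : M, exists x : M, le x s /\ le x t }.

Definition interval (a b : M) : set M := [set x | lt a x /\ lt x b].

Definition co_forest (a : M) : set M :=
  [set x | ~ lt a x /\ forall y, lt y a -> lt y x].

Definition cross_section (a b : M) : set M :=
  [set x | [/\ lt a x, ~ lt b x & ~ co_forest b x]].

End Trees.

Record ltree (L : language) := Ltree {
  tree_structure :> structure L;
  tree_axioms : is_tree tree_structure;
  tree_consts : forall c, retained tree_structure c }.

Definition cs_interval L (T : structure L) (a b : T) : structure (add_pred L) :=
  @expand_pred L (restrict (cross_section a b)) (val @^-1` interval a b).

(* Main.v *)
(* The set underlying the cross section is defined, with the endpoints as
   parameters, by a formula of quantifier rank 1, and the interval by a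
   quantifier-free one.  Relativising quantifiers to a rank-1 guard raises the
   quantifier rank by at most one overall, not by one per quantifier: the guard
   stands beside the relativised matrix, whose rank is bounded by r + 1, and
   max(1, r + 1) = r + 1.  Whether a constant survives the restriction is itself
   expressed by a rank-1 sentence. *)
Require Import Defs.
From mathcomp Require Import all_boot.
From mathcomp Require Import boolp classical_sets.

Set Implicit Arguments.
Unset Strict Implicit.
Unset Printing Implicit Defensive.

Section Relativisation.
Variable L : language.
Let L2 := add_consts L 2.

Definition lo_term V : term L2 V := @Cst L2 V (inr ord0).
Definition hi_term V : term L2 V := @Cst L2 V (inr ord_max).

Definition shift_term V (t : term L2 V) : term L2 (option V) :=
  match t with Var v => Var L2 (Some v) | Cst c => @Cst L2 _ c end.

Definition neg V (f : formula L2 V) : formula L2 V := Imp f (Fls L2 V).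

(** Taking an arbitrary term serves two uses: at [Var None] this guards quantifiers, and at a
    constant it is the rank-1 sentence deciding whether that constant survives the restriction. *)
Definition cs_formula V (t : term L2 V) : formula L2 V :=
  And (Lt (lo_term V) t)
    (And (neg (Lt (hi_term V) t))
      (neg (And (neg (Lt (hi_term V) t))
        (All (Imp (Lt (Var L2 None) (hi_term _))
                  (Lt (Var L2 None) (shift_term t))))))).

Definition rel_term V (t : term (add_pred L) V) : term L2 V :=
  match t with Var v => Var L2 v | Cst c => @Cst L2 V (inl c) end.

Fixpoint relativise V (f : formula (add_pred L) V) : formula L2 V :=
  match f in formula _ V return formula L2 V with
  | Fls V => Fls L2 V
  | Eq _ s t => Eq (rel_term s) (rel_term t)
  | Lt _ s t => Lt (rel_term s) (rel_term t)
  | Prd V p t =>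
      if p is Some q then @Prd L2 V q (rel_term t)
      else And (Lt (lo_term V) (rel_term t)) (Lt (rel_term t) (hi_term V))
  | Imp _ g h => Imp (relativise g) (relativise h)
  | And _ g h => And (relativise g) (relativise h)
  | Or _ g h => Or (relativise g) (relativise h)
  | All _ g => All (Imp (cs_formula (Var L2 None)) (relativise g))
  | Ex _ g => Ex (And (cs_formula (Var L2 None)) (relativise g))
  end.

Lemma qrank_relativise V (f : formula (add_pred L) V) :
  qrank (relativise f) <= (qrank f).+1.
Proof.
elim: f => //= {}V.
- by case.
- by move=> g IHg h IHh; rewrite -maxnSS geq_max !leq_max IHg IHh orbT.
- by move=> g IHg h IHh; rewrite -maxnSS geq_max !leq_max IHg IHh orbT.
- by move=> g IHg h IHh; rewrite -maxnSS geq_max !leq_max IHg IHh orbT.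
- by move=> g IHg; rewrite ltnS geq_max.
- by move=> g IHg; rewrite ltnS geq_max.
Qed.

Section Semantics.
Variables (M : structure L) (a b : M).
Let M2 : structure L2 := expand_consts [tuple a; b].
Let CS : structure (add_pred L) := cs_interval a b.

Lemma sat_cs_formula V (t : term L2 V) (e : V -> M2) (x : M) :
  eval e t = Some x -> sat (cs_formula t) e <-> cross_section a b x.
Proof.
move=> tx.
(* Weakening [t] under the quantifier of [cs_formula] leaves its value unchanged. *)
have tx' y : eval (oapp e y) (shift_term t) = Some x by case: t tx.
rewrite /= tx (tnth_nth a) /= (tnth_nth a) /=; split.
- case=> ax [nbx ncf]; split=> // -[_ cf]; apply: ncf; split=> // y yb.
  by rewrite tx'; exact: cf.
- case=> ax nbx ncf; split=> //; split=> // -[_ cf]; apply: ncf; split=> // y yb.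
  by have := cf y; rewrite tx'; exact.
Qed.

Lemma sat_cs_guard V (e : V -> M2) (x : M2) :
  sat (cs_formula (Var L2 None)) (oapp e x) <-> cross_section a b x.
Proof. exact: sat_cs_formula. Qed.

(** The hypothesis gives [c] a value in [M], and [insub] keeps that value exactly when it lies in
    the cross section. *)
Lemma retained_cs_interval (c : consts L) :
  retained M c ->
  retained CS c <-> models M2 (cs_formula (@Cst L2 void (inl c))).
Proof.
rewrite /retained /models; case cx: (const M c) => [x|] // _.
rewrite (@sat_cs_formula _ _ _ x) //= cx /=.
case: insubP => [u xin _|/negP xnin]; split=> //.
  by move=> _; exact: set_mem.
by move/mem_set.
Qed.

(** A dropped constant is undefined in [CS] but may still denote in [M2]. Excluding it with
    [term_over] makes atoms compare the same points on both sides. *)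
Lemma eval_rel_term V (t : term (add_pred L) V) (e : V -> CS) :
  term_over (retained CS) t ->
  exists2 u : CS, eval e t = Some u
    & eval (M := M2) (fun v => val (e v)) (rel_term t) = Some (val u).
Proof.
case: t => [v _|c]; first by exists (e v).
rewrite /retained /=; case: (const M c) => [x|] //=.
by case: insubP => // u _ <- _; exists u.
Qed.

Lemma oapp_val V (e : V -> CS) (u : CS) :
  (fun v => val (oapp e u v)) = oapp (fun v => val (e v) : M2) (val u).
Proof. by apply: funext; case. Qed.

(** The elements of [CS] are exactly the points of [M] passing the guard, so a quantifier over [CS]
    and a guarded one over [M2] have the same range. The assignment stays general so that the
    induction passes under binders. *)
Lemma sat_relativise V (f : formula (add_pred L) V) (e : V -> CS) :
  formula_over (retained CS) f ->
  sat f e <-> sat (M := M2) (relativise f) (fun v => val (e v)).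
Proof.
elim: f e => {V} [V|V s t|V s t|V p t|V g IHg h IHh|V g IHg h IHh|V g IHg h IHh
                 |V g IHg|V g IHg] e.
- by [].
- case/andP=> /(eval_rel_term e)[u /= -> ->] /(eval_rel_term e)[v -> ->].
  by split=> [->|/val_inj].
- by case/andP=> /(eval_rel_term e)[u /= -> ->] /(eval_rel_term e)[v -> ->].
- case/(eval_rel_term e)=> u eu eu'.
  by case: p => [p|]; rewrite /= eu eu' //= (tnth_nth a) /= (tnth_nth a).
- by case/andP=> og oh; rewrite /= IHg // IHh.
- by case/andP=> og oh; rewrite /= IHg // IHh.
- by case/andP=> og oh; rewrite /= IHg // IHh.
- move=> og; split=> [sg x /sat_cs_guard csx|sg u].
    (* The guard supplies the membership proof that turns the point [x] into an element of [CS]. *)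
    have /(IHg _ og) := sg (SigSub (mem_set csx) : cross_section a b).
    by rewrite oapp_val.
  apply/(IHg _ og); rewrite oapp_val; apply: sg; apply/sat_cs_guard.
  exact: set_mem (valP u).
- move=> og; split=> [[u]|[x [/sat_cs_guard csx sg]]].
    move/(IHg _ og); rewrite oapp_val => sg; exists (val u); split=> //.
    by apply/sat_cs_guard; exact: set_mem (valP u).
  exists (SigSub (mem_set csx) : cross_section a b).
  by apply/(IHg _ og); rewrite oapp_val.
Qed.

Lemma models_relativise (f : sentence (add_pred L)) :
  formula_over (retained CS) f -> models CS f <-> models M2 (relativise f).
Proof.
move=> of_; rewrite /models sat_relativise //.
(* Any two assignments on [void] agree by extensionality. *)
by have -> : (fun v => val (of_void CS v)) = of_void M2 by apply: funext; case.
Qed.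

End Semantics.
End Relativisation.

Lemma formula_over_total L (D : pred (consts L)) V (f : formula L V) :
  (forall c, D c) -> formula_over D f.
Proof.
move=> DT.
have tT W (t : term L W) : term_over D t by case: t => //= c.
by elim: f => //= {}V => [s t|s t|g -> h ->|g -> h ->|g -> h ->] //; rewrite !tT.
Qed.

Lemma eq_formula_over L (D E : pred (consts L)) V (f : formula L V) :
  D =1 E -> formula_over D f = formula_over E f.
Proof.
move=> DE; have tE W (t : term L W) : term_over D t = term_over E t by case: t.
by elim: f => //= {}V => [s t|s t|g -> h ->|g -> h ->|g -> h ->] //; rewrite !tE.
Qed.

Theorem lemma3p5 (n : nat) (L : language) (T S : ltree L) (a b : T) (c d : S)
    (hab : lt a b) (hcd : lt c d)
    (hequiv : nequiv n.+1 (expand_consts [tuple a; b]) (expand_consts [tuple c; d])) :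
  nequiv n (cs_interval a b) (cs_interval c d).
Proof.
case: hequiv => _ agree.
(* Constants of an [ltree] are all retained and the added endpoints always denote, so [agree] is
   limited only by quantifier rank. *)
have total V (f : formula _ V) :
    formula_over (retained (expand_consts [tuple a; b])) f.
  apply: formula_over_total; case=> // k; exact: tree_consts.
have eq_ret : retained (cs_interval a b) =1 retained (cs_interval c d).
  move=> k; have kT := retained_cs_interval a b (@tree_consts L T k).
  have kS := retained_cs_interval c d (@tree_consts L S k).
  (* Survival is a rank-1 sentence, hence within the bound [n.+1] even for [n = 0]. *)
  by apply/idP/idP=> [/kT|/kS] ret; [apply/kS/agree | apply/kT/agree].
split=> // f over_f rank_f.
(* [over_f] concerns the first cross section only; [eq_ret] carries it to the second. *)
rewrite !models_relativise //; last by rewrite -(eq_formula_over _ eq_ret).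
by apply: agree => //; exact: leq_trans (qrank_relativise f) _.
Qed.
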